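(* Let $n\ge 1$ be an integer, let $X$ be a combinatorially $n$-essential simplicial complex, and let $r$ be the homotopy triviality radius of $X$. Then there exists a vertex $x\in V(X)$ such that for every $i=0,\ldots,r+1$ the number of vertices in $B(x,i)$ is at least $b_n(i)$, where the positive integers $b_m(i)$ ($m\ge 1$, $0\le i\le r+1$) are determined by the following recursive relations: \begin{itemize} \item $b_1(i) = 2i+1$ for any $i=0,\ldots,r$, and $b_1(r+1)= 2r+2$; \item $b_m(i) = \sum_{0\le j\le i}b_{m-1}(j)$ for any $m\ge 2$ and $i=0,\ldots,r+1$. \end{itemize} In particular, $b_n(i) \ge 2\binom{i + n -1}{n} + \binom{i + n-1}{n-1}$ for any $i=0,\ldots,r$, and $b_n(r+1)\ge 2\binom{r + n}{n} + \binom{r + n}{n-1} - 1$.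
   Context: For a simplicial complex $X$, $V(X)$ denotes its vertex set. For $W\subset V(X)$, $\langle W\rangle$ denotes the induced subcomplex, consisting of all faces of $X$ whose vertices all lie in $W$. For $x\in V(X)$ and an integer $i$, $B(x,i)\subset V(X)$ is the set of vertices whose edge-distance to $x$ is at most $i$. The (edge-path) systole $\operatorname{sys} X$ is the smallest integer such that every closed path along the edges of $X$ of edge-length less than $\operatorname{sys} X$ is null-homotopic in $X$ (and $+\infty$ if every component of $X$ is simply connected). A subset $Y\subset V(X)$ is called inessential if for every connected component $C$ of $\langle Y\rangle$, with $D$ the connected component of $X$ containing $C$, the natural map $\pi_1(C)\to\pi_1(D)$ is trivial. The complex $X$ is combinatorially $n$-essential if $V(X)$ cannot be partitioned into $n$ or fewer inessential sets. (For $n\ge1$ such a complex has finite systole.) The homotopy triviality radius of a complex $X$ with finite systole is $r:=\left\lfloor\frac{\operatorname{sys} X}{2}\right\rfloor-1$; equivalently, it is the maximum integer $r$ such that every metric ball $B(x,r)\subseteq V(X)$, $x\in V(X)$, is inessential. *)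

(* Defs.v *)
From Stdlib Require Import Relations.Relation_Operators.
From mathcomp Require Import all_boot.
From mathcomp Require Import finmap.
From mathcomp Require Import boolp classical_sets functions cardinality.

Set Implicit Arguments.
Unset Strict Implicit.
Unset Printing Implicit Defensive.

Local Open Scope classical_set_scope.
Local Open Scope fset_scope.

(* No finiteness or local finiteness is assumed. The elements of [V] that are
   not vertices of the complex play no role; this makes every subcomplex of a
   complex on [V] again a complex on [V]. *)
Record simplicial_complex (V : choiceType) := SimplicialComplex {
  faces :> set {fset V};
  face_neq0 : ~ faces fset0;
  face_sub : forall s t : {fset V},
    faces s -> t `<=` s -> t != fset0 -> faces t }.

Section Complexes.
Variable V : choiceType.
Implicit Types (X C D : simplicial_complex V) (W Y : set V).
Implicit Types (x y v : V) (p : seq V).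

Definition vertices X : set V := [set v | faces X [fset v]].

Lemma induced_neq0 X W :
  ~ [set s | faces X s /\ forall v, v \in s -> W v]%classic fset0.
Proof. by case=> /face_neq0. Qed.

Lemma induced_sub X W (s t : {fset V}) :
  [set s | faces X s /\ forall v, v \in s -> W v]%classic s ->
  t `<=` s -> t != fset0 ->
  [set s | faces X s /\ forall v, v \in s -> W v]%classic t.
Proof.
move=> [Xs Ws] ts t0; split; first exact: face_sub Xs ts t0.
by move=> v /(fsubsetP ts); exact: Ws.
Qed.

Definition induced X W : simplicial_complex V :=
  SimplicialComplex (@induced_neq0 X W) (@induced_sub X W).

Definition edge X : rel V :=
  fun u v => (u != v) && `[< faces X [fset u; v] >].

(* An edge path is given by its first vertex [x] and the sequence [p] of the
   following ones; its edge-length is [size p]. *)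
Definition edge_path X x p : Prop := vertices X x /\ path (edge X) x p.

Definition closed_edge_path X x p : Prop := edge_path X x p /\ last x p = x.

Definition edge_connected X x y : Prop :=
  exists2 p, edge_path X x p & last x p = y.

(* The connected component of [X] containing the vertex [x]. *)
Definition component X x : simplicial_complex V :=
  induced X (edge_connected X x).

(* [edge_ball X x i] is the set B(x, i) for the edge-distance of [X]. *)
Definition edge_ball X x (i : nat) : set V :=
  [set y | exists p, [/\ edge_path X x p, last x p = y & size p <= i]]%classic.

(* The fundamental group is the edge-path group: edge paths, written as the
   sequences of all their vertices, modulo the equivalence relation generated
   by removing a backtracking [a b a] and by pushing two sides [a b c] of a
   2-face to the third one. Both moves fix the endpoints. *)
Inductive elementary_homotopy X : seq V -> seq V -> Prop :=
| elementary_backtrack s t a b : edge X a b ->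
    elementary_homotopy X (s ++ [:: a, b, a & t]) (s ++ a :: t)
| elementary_triangle s t a b c : uniq [:: a; b; c] ->
    faces X [fset a; b; c] ->
    elementary_homotopy X (s ++ [:: a, b, c & t]) (s ++ [:: a, c & t]).

Definition homotopic X : seq V -> seq V -> Prop :=
  clos_refl_sym_trans (seq V) (elementary_homotopy X).

Definition null_homotopic X x p : Prop := homotopic X (x :: p) [:: x].

(* For a subcomplex [C] of [D]: the natural map from the fundamental group of
   [C] to that of [D] is trivial at every base point. *)
Definition trivial_on_pi1 C D : Prop :=
  forall x p, closed_edge_path C x p -> null_homotopic D x p.

Definition inessential X Y : Prop :=
  forall v, vertices (induced X Y) v ->
    trivial_on_pi1 (component (induced X Y) v) (component X v).

(* The blocks of a [partition] are nonempty and pairwise disjoint. *)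
Definition combinatorially_essential (n : nat) X : Prop :=
  ~ exists m, exists P : nat -> set V,
    [/\ m <= n, partition `I_m P (vertices X) &
        forall i, i < m -> inessential X (P i)].

Definition short_null_homotopic X (s : nat) : Prop :=
  forall x p, closed_edge_path X x p -> size p < s -> null_homotopic X x p.

(* [is_systole X s]: the systole of [X] is finite and equal to [s], the
   largest integer such that all closed edge paths of length less than [s] are
   null-homotopic, i.e. the least length of a closed edge path that is not. *)
Definition is_systole X (s : nat) : Prop :=
  short_null_homotopic X s /\ forall t, short_null_homotopic X t -> t <= s.

(* The subtraction is never truncated, by [systole_gt2] below. *)
Definition is_homotopy_triviality_radius X (r : nat) : Prop :=
  exists2 s, is_systole X s & r = s./2 - 1.

Lemma systole_unique X s t : is_systole X s -> is_systole X t -> s = t.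
Proof.
by move=> [s1 s2] [t1 t2]; apply/eqP; rewrite eqn_leq t2 // s2.
Qed.

Lemma systole_gt2 X s : is_systole X s -> 2 < s.
Proof.
move=> [_]; apply=> x [|a [|b [|c p]]] //=; first by move=> *; exact: rst_refl.
  by move=> [[_ /=]]; rewrite andbT => /andP[/eqP xa _] ax; case: xa.
move=> [[_ /= /and3P[xa _ _]] ->] _.
exact/rst_step/(elementary_backtrack [::] [::] xa).
Qed.

Lemma vertices_induced X W v : vertices (induced X W) v <-> vertices X v /\ W v.
Proof.
split=> [[Xv Wv]|[Xv Wv]]; split=> //; first by apply: Wv; rewrite in_fset1.
by move=> u; rewrite in_fset1 => /eqP ->.
Qed.

Lemma edge_induced X W u v : edge (induced X W) u v -> edge X u v.
Proof.
by move=> /andP[uv /asboolP[Xuv _]]; rewrite /edge uv; apply/asboolP.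
Qed.

Lemma edge_vertex X u v : edge X u v -> vertices X u /\ vertices X v.
Proof.
move=> /andP[_ /asboolP Xuv]; split; apply: (face_sub Xuv).
- by rewrite fsub1set !inE eqxx.
- by apply/fset0Pn; exists u; rewrite in_fset1.
- by rewrite fsub1set !inE eqxx orbT.
- by apply/fset0Pn; exists v; rewrite in_fset1.
Qed.

Lemma edge_connected_refl X x : vertices X x -> edge_connected X x x.
Proof. by move=> Xx; exists [::]. Qed.

Lemma edge_connected_edge X x u v :
  edge_connected X x u -> edge X u v -> edge_connected X x v.
Proof.
move=> [p [Xx xp] <-] uv; exists (rcons p v); last by rewrite last_rcons.
by split; rewrite // rcons_path xp.
Qed.

Lemma face_edge X (s : {fset V}) u v :
  faces X s -> u \in s -> v \in s -> u != v -> edge X u v.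
Proof.
move=> Xs us vs uv; apply/andP; split=> //; apply/asboolP.
apply: (face_sub Xs); first by apply/fsubsetP => w; rewrite !inE => /orP[]/eqP->.
by apply/fset0Pn; exists u; rewrite !inE eqxx.
Qed.

Lemma face_component X x (s : {fset V}) u :
  faces X s -> u \in s -> edge_connected X x u -> faces (component X x) s.
Proof.
move=> Xs us xu; split=> // w ws.
have [<- //|uw] := eqVneq u w.
exact: edge_connected_edge xu (face_edge Xs us ws uw).
Qed.

(* A homotopy in [X] between edge paths stays in their component. *)
Lemma homotopic_component X x (p q : seq V) : homotopic X p q ->
  (forall v, v \in p -> edge_connected X x v) -> homotopic (component X x) p q.
Proof.
move=> pq; suff [_ //] : ((forall v, v \in p -> edge_connected X x v) <->
    (forall v, v \in q -> edge_connected X x v)) /\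
  ((forall v, v \in p -> edge_connected X x v) ->
     homotopic (component X x) p q).
elim: pq => {p q} [_ _ [s t a b ab|s t a b c u Xs]|p|p q _ [pq hpq]|
    p q w _ [pq hpq] _ [qw hqw]].
- split; first split=> H v.
  + by move=> vin; apply: H; move: vin; rewrite !(mem_cat, inE) => /or3P[]->;
      rewrite ?orbT.
  + have xa : edge_connected X x a by apply: H; rewrite mem_cat !inE eqxx orbT.
    rewrite !(mem_cat, inE) => /or4P[vs|/eqP->//|/eqP->|/orP[/eqP->//|vt]].
    * by apply: H; rewrite mem_cat vs.
    * exact: edge_connected_edge xa ab.
    * by apply: H; rewrite mem_cat inE vt !orbT.
  + move=> H; apply/rst_step/elementary_backtrack.
    have xa : edge_connected X x a by apply: H; rewrite mem_cat !inE eqxx orbT.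
    have /andP[nab /asboolP Xab] := ab.
    apply/andP; split=> //; apply/asboolP.
    by apply: (face_component Xab _ xa); rewrite !inE eqxx.
- split; first split=> H v.
  + by move=> vin; apply: H; move: vin; rewrite !(mem_cat, inE) => /or4P[]->;
      rewrite ?orbT.
  + have xa : edge_connected X x a by apply: H; rewrite mem_cat !inE eqxx orbT.
    have [_ xs] : faces (component X x) [fset a; b; c]
      by apply: (face_component Xs _ xa); rewrite !inE eqxx.
    rewrite !(mem_cat, inE) => /or4P[vs|/eqP->//|/eqP->|/orP[/eqP->|vt]].
    * by apply: H; rewrite mem_cat vs.
    * by apply: xs; rewrite !inE eqxx !orbT.
    * by apply: xs; rewrite !inE eqxx !orbT.
    * by apply: H; rewrite mem_cat !inE vt !orbT.
  + move=> H; apply/rst_step/elementary_triangle => //.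
    have xa : edge_connected X x a by apply: H; rewrite mem_cat !inE eqxx orbT.
    by apply: (face_component Xs _ xa); rewrite !inE eqxx.
- by split=> // _; exact: rst_refl.
- by split; [split=> /pq | move=> /pq/hpq; exact: rst_sym].
- split; first by split=> [/pq/qw|/qw/pq].
  by move=> H; apply: rst_trans (hpq H) _; apply: hqw; apply/pq.
Qed.

Lemma edge_connected_mem X x y p v : edge_connected X x y ->
  path (edge X) y p -> v \in y :: p -> edge_connected X x v.
Proof.
elim: p y => [|z p IH] y xy /=; first by rewrite inE => _ /eqP->.
move=> /andP[yz zp]; rewrite inE => /orP[/eqP->//|].
by apply: IH => //; exact: edge_connected_edge xy yz.
Qed.

Lemma inessential_vertices X :
  (forall s, short_null_homotopic X s) -> inessential X (vertices X).
Proof.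
move=> short v /vertices_induced[Xv _] y p [[/vertices_induced[Yy vy] yp] yl].
have sub W u w : edge (component (induced X W) v) u w -> edge X u w.
  by move=> /edge_induced/edge_induced.
have yp' : path (edge X) y p by apply: sub_path yp => u w /sub.
have [q [_ vq] qy] := vy.
have vy' : edge_connected X v y.
  by exists q => //; split=> //; apply: sub_path vq => u w /edge_induced.
apply: homotopic_component.
  apply: (short (size p).+1) => //; split=> //; split=> //.
  by have /vertices_induced[] := Yy.
by move=> w; exact: edge_connected_mem vy' yp'.
Qed.

Lemma essential_systole n X : 1 <= n -> combinatorially_essential n X ->
  exists s, is_systole X s.
Proof.
move=> n1 ess; have [short|] := pselect (forall s, short_null_homotopic X s).
  exfalso; apply: ess; have [X0|Xn0] := eqVneq (vertices X) set0.
    exists 0, (fun=> set0); split=> //; split=> //.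
    by rewrite /cover X0 bigcup0.
  exists 1, (fun=> vertices X); split=> //; last first.
    by move=> _ _; exact: inessential_vertices.
  split; last by move=> _ _; exact/set0P.
    by rewrite /cover II1 bigcup_set1.
  by rewrite II1 => i j -> ->.
move=> /existsNP nshort.
have exn : exists s, `[< ~ short_null_homotopic X s >].
  by have [s ns] := nshort; exists s; apply/asboolP.
have [[|k] /asboolP nk mk] := ex_minnP exn; first by case: nk.
exists k; split.
  apply: contrapT => nsk.
  by have := mk k; rewrite ltnn => /(_ (introT (asboolP _) nsk)).
move=> t st; rewrite leqNgt; apply/negP => kt; apply: nk => x p xp pk.
by apply: st xp _; exact: leq_trans pk kt.
Qed.

End Complexes.

Local Open Scope nat_scope.

(* [vertex_bound r m i] is b_m(i), for m >= 1 and i <= r + 1; the value at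
   m = 0 is junk. *)
Fixpoint vertex_bound (r m i : nat) : nat :=
  match m with
  | 0 => 0
  | m'.+1 =>
    if m' is 0 then (if i <= r then 2 * i + 1 else 2 * r + 2)
    else \sum_(0 <= j < i.+1) vertex_bound r m' j
  end.

(* Main.v *)
Require Import Defs.
From Stdlib Require Import Relations.Relation_Operators.
From mathcomp Require Import all_boot zify.
From mathcomp Require Import finmap.
From mathcomp Require Import boolp classical_sets functions cardinality filter.

(** Call a set of vertices trivial when every loop of the complex that runs
    inside it is null-homotopic in the complex. If the complex is n-essential,
    then its vertices have no colouring with n colours and trivial colour
    classes. As a loop visits finitely many vertices, a compactness argument
    ([colorable_compact]) yields a finite set [W] of vertices without such a
    colouring, and the vertices of [W] in the balls of the complex are counted
    by induction on n ([not_colorable_ball]).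

    For n = 1 the set [W] carries a loop that is not null-homotopic; cutting it
    at repeated vertices makes it simple ([nonnull_uniq_loop]). Its length is at
    least the systole, hence at least 2r + 2, so that around each of its
    vertices the two arcs of length i are disjoint for i <= r, and they cover at
    least 2r + 2 vertices for i = r + 1 ([loop_ball_card]).

    For larger n, take the smallest [Z] inside [W] whose complement in [W] is
    trivial. One colour suffices for the complement, so [Z] has no colouring
    with n - 1 colours, and the induction hypothesis gives a centre x. Balls of
    radius i <= r are trivial ([pi1_trivial_ball]). Trading the part of [Z] in
    B(x, i + 1) for the sphere of radius i + 1 around x only adds B(x, i) to the
    complement, detached from the rest, and so keeps the complement trivial. As
    [Z] is smallest, the sphere has at least as many vertices of [W] as
    B(x, i + 1) has vertices of [Z] ([sphere_geq]). Summing the spheres gives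
    the recursion that defines the bounds, and Pascal's rule gives their closed
    forms. *)

Set Implicit Arguments.
Unset Strict Implicit.
Unset Printing Implicit Defensive.

Local Open Scope fset_scope.
Local Open Scope nat_scope.

(** * Homotopies of edge paths *)

Section Homotopy.
Variables (V : choiceType) (X : simplicial_complex V).
Implicit Types (x y z : V) (p q s t : seq V).

Lemma homotopic_refl p : homotopic X p p.
Proof. exact: rst_refl. Qed.

Lemma homotopic_sym p q : homotopic X p q -> homotopic X q p.
Proof. exact: rst_sym. Qed.

Lemma homotopic_trans q p s :
  homotopic X p q -> homotopic X q s -> homotopic X p s.
Proof. exact: rst_trans. Qed.

Lemma homotopic_cat s t p q :
  homotopic X p q -> homotopic X (s ++ p ++ t) (s ++ q ++ t).
Proof.
elim=> {p q} [p q pq|p|p q _ pq|p q w _ pq _ qw].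
- apply: rst_step; case: pq => [s' t' a b ab|s' t' a b c abc Xabc].
  + rewrite -!catA !(catA s); exact: elementary_backtrack.
  + rewrite -!catA !(catA s); exact: elementary_triangle.
- exact: rst_refl.
- exact: rst_sym.
- exact: rst_trans pq qw.
Qed.

Lemma homotopic_catl s p q : homotopic X p q -> homotopic X (s ++ p) (s ++ q).
Proof. by move=> /(homotopic_cat s [::]); rewrite !cats0. Qed.

Lemma homotopic_catr t p q : homotopic X p q -> homotopic X (p ++ t) (q ++ t).
Proof. exact: (homotopic_cat [::]). Qed.

Lemma edgeC x y : edge X x y = edge X y x.
Proof. by rewrite /edge eq_sym fsetUC. Qed.

Lemma homotopic_rev_cat x p : path (edge X) x p ->
  homotopic X (rev p ++ x :: p) [:: last x p].
Proof.
elim: p x => [|z p IH] x /=; first by move=> _; exact: homotopic_refl.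
move=> /andP[xz zp]; apply: homotopic_trans (IH _ zp).
rewrite rev_cons cat_rcons; apply/rst_step/elementary_backtrack.
by rewrite edgeC.
Qed.

(** A path [p] is homotopic to [p q^-1 q], hence to [q] when the loop [p q^-1]
    is null-homotopic. *)
Lemma homotopic_of_loop x p q :
  path (edge X) x q -> last x p = last x q ->
  null_homotopic X x (p ++ rev (belast x q)) -> homotopic X (x :: p) (x :: q).
Proof.
move=> xq pq /(homotopic_catr q) /= H.
apply: homotopic_trans H; rewrite -catA.
have /(homotopic_catl (belast x p))/homotopic_sym := homotopic_rev_cat xq.
rewrite -pq cats1 -lastI => /homotopic_trans; apply.
rewrite -[_ :: p ++ _]cat_cons [x :: p]lastI cat_rcons pq.
rewrite -[rev q ++ _]/(rev q ++ [:: x] ++ q).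
rewrite (catA (rev q)) cats1 -rev_cons lastI rev_rcons; exact: homotopic_refl.
Qed.

Lemma path_rev_belast x p : path (edge X) x p ->
  path (edge X) (last x p) (rev (belast x p)).
Proof. by rewrite rev_path; apply: sub_path => u v; rewrite edgeC. Qed.

Lemma last_rev_belast x p : last (last x p) (rev (belast x p)) = x.
Proof. by case: p => //= y p; rewrite rev_cons last_rcons. Qed.

End Homotopy.

(** * Sets of vertices whose loops are contractible *)

Section Pi1Trivial.
Variables (V : choiceType) (X : simplicial_complex V).
Implicit Types (x y z : V) (p q s t : seq V) (W Y : set V).

(** The loops are contracted in [X], not in the induced subcomplex: this is the
    form of inessentiality that passes to subsets and can be tested on finite
    ones. *)
Definition pi1_trivial Y : Prop :=
  forall x p, closed_edge_path X x p -> (forall v, v \in x :: p -> Y v) ->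
    null_homotopic X x p.

Lemma pi1_trivial_sub Y W : (W `<=` Y)%classic -> pi1_trivial Y -> pi1_trivial W.
Proof. by move=> WY tY x p xp Wp; apply: tY => // v /Wp/WY. Qed.

Lemma pi1_trivial_inessential Y : pi1_trivial Y -> inessential X Y.
Proof.
move=> tY v _ y p [[/vertices_induced[Yy vy] yp] yl].
have sub u w : edge (component (induced X Y) v) u w -> edge X u w.
  by move=> /edge_induced/edge_induced.
have yp' : path (edge X) y p by apply: sub_path yp.
have [q [_ vq] qy] := vy.
have vy' : edge_connected X v y.
  exists q => //; split; last by apply: sub_path vq => u w /edge_induced.
  by case: vy => q' [/vertices_induced[]].
have /vertices_induced[Xy Yy'] := Yy.
apply: homotopic_component; last by move=> w; exact: edge_connected_mem vy' yp'.
apply: tY => // w; rewrite inE => /orP[/eqP->//|].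
elim: p y yp {yl yp' qy vy vy' Yy Xy Yy'} => //= z p IH y /andP[yz zp].
rewrite inE => /orP[/eqP->|]; last exact: IH zp.
by have [_ /vertices_induced[/vertices_induced[]]] := edge_vertex yz.
Qed.

(** A path cannot pass from one of the two sets to the other. *)
Lemma pi1_trivial_setU Y W :
  (forall u v, Y u -> W v -> ~~ edge X u v) ->
  pi1_trivial Y -> pi1_trivial W -> pi1_trivial (Y `|` W)%classic.
Proof.
move=> YW tY tW x p [[Xx xp] xl] YWp.
have stay (A B : set V) : (forall u v, A u -> B v -> ~~ edge X u v) ->
    (forall v, v \in x :: p -> A v \/ B v) -> A x ->
    forall v, v \in x :: p -> A v.
  move=> AB; elim: p x xp {YWp xl Xx} => [|z p IH] x /=.
    by move=> _ _ Ax v; rewrite inE => /eqP->.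
  move=> /andP[xz zp] ABp Ax v; rewrite inE => /orP[/eqP->//|].
  apply: IH => //; first by move=> u up; apply: ABp; rewrite inE up orbT.
  have [//|Bz] : A z \/ B z by apply: ABp; rewrite !inE eqxx orbT.
  by have := AB _ _ Ax Bz; rewrite xz.
have [Yx|Wx] := YWp x (mem_head _ _).
- by apply: tY => //; apply: (stay _ W).
- apply: tW => //; apply: (stay _ Y) => //.
  + by move=> u v Wu Yv; rewrite edgeC; exact: YW.
  + by move=> v /YWp[]; [right|left].
Qed.

(** Joining the vertices of a loop in the ball to the centre [x] by paths of
    length at most [r] cuts the loop into sectors. Each sector is a loop of
    length at most [2 * r + 1], hence null-homotopic. *)
Lemma pi1_trivial_ball r x :
  short_null_homotopic X (2 * r + 2) -> pi1_trivial (edge_ball X x r).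
Proof.
move=> short.
(* [g] and [g'] join [x] to the ends of [p]: the cone over [p] deforms [g p] to
   [g'], one sector at each step of the induction. *)
have cone y p g g' : edge_path X x g -> last x g = y -> size g <= r ->
    path (edge X) y p -> (forall v, v \in y :: p -> edge_ball X x r v) ->
    edge_path X x g' -> last x g' = last y p -> size g' <= r ->
    homotopic X (x :: g ++ p) (x :: g').
  move=> xg gy gr; elim: p y g xg gy gr => [|z p IH] y g [Xx xg] gy gr /=.
    move=> _ _ [_ xg'] g'y g'r; rewrite cats0.
    apply: homotopic_of_loop => //; first by rewrite gy g'y.
    apply: short; last by rewrite size_cat size_rev size_belast; lia.
    split; last by rewrite last_cat gy -g'y last_rev_belast.
    by split=> //; rewrite cat_path xg /= gy -g'y path_rev_belast.
  move=> /andP[yz zp] Bp g'x g'z g'r.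
  have [h [[_ xh] hz hr]] : edge_ball X x r z by apply: Bp; rewrite !inE eqxx orbT.
  have IHh : homotopic X (x :: h ++ p) (x :: g').
    by apply: (IH z) => // v vp; apply: Bp; rewrite inE vp orbT.
  apply: homotopic_trans IHh; rewrite -cat_rcons -!cat_cons.
  apply: homotopic_catr; apply: homotopic_of_loop => //.
    by rewrite last_rcons.
  apply: short; last by rewrite size_cat size_rev size_rcons size_belast; lia.
  split; last by rewrite last_cat last_rcons -hz last_rev_belast.
  split=> //; rewrite cat_path rcons_path xg gy yz last_rcons /= -hz.
  exact: path_rev_belast.
move=> y p [[Xy yp] yl] Bp.
have [g [xg gy gr]] := Bp y (mem_head _ _).
have := cone y p g g xg gy gr yp Bp xg; rewrite yl => /(_ gy gr).
move=> /(homotopic_catl (rev g)); rewrite -cat_cons catA => H.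
have xgp := homotopic_rev_cat xg.2.
move: (xgp) => /(homotopic_catr p)/homotopic_sym; rewrite gy.
move=> /homotopic_trans; apply; apply: homotopic_trans H _.
by rewrite -gy.
Qed.

End Pi1Trivial.

(** * Colourings with trivial colour classes *)

Section Coloring.
Variables (V : choiceType) (X : simplicial_complex V).
Implicit Types (x y z : V) (p q : seq V) (W Y : set V) (n k : nat).

Definition colorable n W : Prop :=
  exists c : V -> nat, (forall v, W v -> c v < n) /\
    forall k, pi1_trivial X [set v | W v /\ c v = k]%classic.

Lemma colorable1 W : pi1_trivial X W -> colorable 1 W.
Proof.
move=> tW; exists (fun=> 0); split=> // k.
by apply: pi1_trivial_sub tW => v [].
Qed.

Lemma colorable_setD n W Z : colorable n Z -> pi1_trivial X (W `\` Z)%classic ->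
  colorable n.+1 W.
Proof.
move=> [c [cn tc]] tWZ; exists (fun v => if `[< Z v >] then c v else n); split.
  by move=> v Wv; case: asboolP => // /cn/ltnW.
move=> k; have [->|kn] := eqVneq k n.
- apply: pi1_trivial_sub tWZ => v [Wv]; case: asboolP => // Zv cvn.
  by have := cn v Zv; rewrite cvn ltnn.
- apply: pi1_trivial_sub (tc k) => v [Wv]; case: asboolP => // _ nk.
  by rewrite nk eqxx in kn.
Qed.

(** The classes of a colouring are the blocks sought, once the unused colours
    have been dropped. *)
Lemma colorable_not_essential n :
  colorable n (vertices X) -> ~ combinatorially_essential n X.
Proof.
move=> [c [cn tc]]; apply; pose block k := [set v | vertices X v /\ c v = k]%classic.
pose s := [seq k <- iota 0 n | `[< exists v, block k v >]].
exists (size s), (fun i => block (nth n s i)); split.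
- by rewrite size_filter -[leqRHS](size_iota 0) count_size.
- split.
  + apply/seteqP; split=> [v [i _ []//]|v Xv].
    have cs : c v \in s.
      rewrite mem_filter mem_iota add0n cn // !andbT.
      by apply/asboolP; exists v.
    by exists (index (c v) s); [rewrite /= index_mem | split; rewrite ?nth_index].
  + move=> i j /= si sj [v [[_ ci] [_ cj]]].
    move: cj => /eqP.
    by rewrite ci nth_uniq // ?filter_uniq ?iota_uniq // => /eqP.
  + move=> i /= si; have := mem_nth n si; rewrite mem_filter => /andP[/asboolP[v]].
    by exists v.
- by move=> i _; apply: pi1_trivial_inessential; exact: tc.
Qed.

(** De Bruijn-Erdos compactness: a path visits finitely many vertices, hence a
    colouring that agrees with a good one on every finite set is good. Such a
    colouring is the limit of good colourings of the finite sets along an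
    ultrafilter that contains, for each finite set, the family of the finite
    sets above it. *)
Lemma colorable_compact n : (forall W : {fset V}, colorable n [set` W]%classic) ->
  colorable n (vertices X).
Proof.
move=> /choice[col good].
pose above (S : {fset V}) : set {fset V} := [set W | (S `<=` W)%fset]%classic.
have properF : ProperFilter (filter_from setT above).
  apply: filter_from_proper; last by move=> S _; exists S; exact: fsubset_refl.
  apply: filter_from_filter; first by exists fset0.
  move=> S T _ _; exists (S `|` T)%fset => // W /= STW.
  by split; apply: fsubset_trans STW; rewrite ?fsubsetUl ?fsubsetUr.
have [U [ultraU FU]] := ultraFilterLemma properF.
have Umem v : U [set W : {fset V} | v \in W]%classic.
  by apply: FU; exists [fset v] => // W; rewrite /above /= fsub1set.
have /choice[c Uc] v : exists k, U [set W : {fset V} | col W v = k /\ v \in W]%classic.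
  have [[k Uk]|noc] := pselect (exists k, U [set W : {fset V} | col W v = k]%classic).
    by exists k; apply: filterS (filterI Uk (Umem v)).
  have Un : U [set W : {fset V} | forall k : 'I_n, col W v <> k]%classic.
    apply: (filter_forall (f := fun k : 'I_n => [set W | col W v <> k]%classic)) => k.
    by have [Uk|//] := in_ultra_setVsetC [set W | col W v = k]%classic ultraU;
      case: noc; exists k.
  have [W [Wn Wv]] := filter_ex (filterI Un (Umem v)).
  have cn := (good W).1 _ Wv.
  by case: (Wn (Ordinal cn)).
exists c; split=> [v _|k].
  by have [W [<- /(good W).1]] := filter_ex (Uc v).
move=> x p xp ck.
have [W Wp] := filter_ex (filter_bigI (D := [fset v in x :: p]) _ (fun v _ => Uc v)).
apply: ((good W).2 k) => // v vp.
have vp' : v \in [fset v in x :: p] by rewrite in_fset.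
have [colv Wv] := Wp v vp'.
by have [_ cv] := ck _ vp; split; rewrite ?colv.
Qed.

End Coloring.

(** * Counting vertices in balls *)

Section Balls.
Variables (V : choiceType) (X : simplicial_complex V).
Implicit Types (x y z : V) (p q : seq V) (n k : nat).

Definition trace (W : {fset V}) (Y : set V) : {fset V} :=
  [fset v in W | `[< Y v >]].

Lemma in_trace W Y v : (v \in trace W Y) = (v \in W) && `[< Y v >].
Proof. by rewrite !inE. Qed.

Lemma edge_ball_step x i u v :
  edge_ball X x i u -> edge X u v -> edge_ball X x i.+1 v.
Proof.
move=> [p [[Xx xp] pu pi]] uv; exists (rcons p v).
by split; rewrite ?last_rcons ?size_rcons //; split; rewrite // rcons_path xp pu.
Qed.

Lemma edge_ball_leq x i j : i <= j -> (edge_ball X x i `<=` edge_ball X x j)%classic.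
Proof. by move=> ij v [p [xp pv pi]]; exists p; split=> //; exact: leq_trans ij. Qed.

(** In the smallest set [Z] with trivial complement, replace the part in the
    ball of radius [i.+1] by the sphere bounding that ball. The complement keeps
    its part outside the ball and gains the inside of the sphere, which is
    trivial and not adjacent to the outside. By minimality, the sphere is at
    least as large as the part that it replaces. *)
Lemma sphere_geq (W Z : {fset V}) x i :
  pi1_trivial X [set v | v \in (W `\` Z)%fset]%classic ->
  (forall Z' : {fset V}, Z' `<=` W ->
     pi1_trivial X [set v | v \in (W `\` Z')%fset]%classic -> #|` Z| <= #|` Z'|) ->
  Z `<=` W -> pi1_trivial X (edge_ball X x i) ->
  #|` trace W (edge_ball X x i)| + #|` trace Z (edge_ball X x i.+1)| <=
  #|` trace W (edge_ball X x i.+1)|.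
Proof.
move=> tZ minZ ZW tB.
set B := edge_ball X x i; set B' := edge_ball X x i.+1.
pose S := trace W B' `\` trace W B.
have BB' : trace W B `<=` trace W B'.
  apply/fsubsetP=> v; rewrite !in_trace => /andP[-> /asboolP Bv] /=.
  by apply/asboolP; exact: edge_ball_leq Bv.
have cS : #|` trace W B| + #|` S| = #|` trace W B'|.
  by rewrite cardfsDS // subnKC // fsubset_leq_card.
have cZ : #|` trace Z B'| + #|` Z `\` trace Z B'| = #|` Z|.
  have ZB' : trace Z B' `<=` Z.
    by apply/fsubsetP=> v; rewrite in_trace => /andP[].
  by rewrite cardfsDS // subnKC // fsubset_leq_card.
suff : #|` Z| <= #|` (Z `\` trace Z B') `|` S|.
  by have := cardfsUI (Z `\` trace Z B') S; lia.
apply: minZ.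
  apply/fsubsetP => v; rewrite !(inE, in_trace) => /orP[/andP[_ /(fsubsetP ZW)//]|].
  by case/and3P.
have outside : pi1_trivial X [set v | v \in (W `\` Z)%fset /\ ~ B' v]%classic.
  by apply: pi1_trivial_sub tZ => v [].
apply: pi1_trivial_sub (pi1_trivial_setU _ tB outside).
- move=> v; rewrite /= !(inE, in_trace) => /andP[+ Wv]; rewrite Wv /=.
  case: (asboolP (B v)) => [Bv|nBv]; first by left.
  case: (asboolP (B' v)) => [//|nB'v]; rewrite ?andbT ?orbT ?andbF ?orbF //=.
  by move=> nZ; right; split=> //; rewrite !inE Wv andbT; move: nZ; case: (v \in Z).
- move=> u v Bu [_ nB'v]; apply/negP => uv; apply: nB'v.
  exact: edge_ball_step uv.
Qed.

(** At a repeated vertex a loop splits into two shorter ones. If both were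
    null-homotopic, so would be the loop itself. *)
Lemma nonnull_uniq_loop x p : closed_edge_path X x p -> ~ null_homotopic X x p ->
  exists y q, [/\ closed_edge_path X y q, uniq q, ~ null_homotopic X y q &
                  {subset y :: q <= x :: p}].
Proof.
have dup q : ~~ uniq q -> exists a y b d, q = a ++ y :: b ++ y :: d.
  elim: q => //= z q IH; rewrite negb_and negbK => /orP[|/IH].
    by move=> /splitPr[b d]; exists [::], z, b, d.
  by move=> [a [y [b [d ->]]]]; exists (z :: a), y, b, d.
move: {2}(size p).+1 (ltnSn (size p)) => m; elim: m x p => // m IH x p pm xp np.
have [up|/dup[a [y [b [d pE]]]]] := boolP (uniq p); first by exists x, p; split=> // v.
have [[Xx +] +] := xp; rewrite pE !(cat_path, last_cat) /=.
rewrite cat_path last_cat /= => /and3P[xa ay /and3P[yb bby yd]] dl.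
have Xy : vertices X y by have [] := edge_vertex ay.
have cb : closed_edge_path X y (rcons b y).
  by split; rewrite ?last_rcons //; split; rewrite // rcons_path yb.
have cd : closed_edge_path X x (a ++ y :: d).
  by split; rewrite ?last_cat //; split; rewrite // cat_path xa /= ay.
have [nb|nb] := pselect (null_homotopic X y (rcons b y)); last first.
  have [|z [q [zq uq nq sub]]] := IH y (rcons b y) _ cb nb.
    by move: pm; rewrite pE !(size_rcons, size_cat) /= size_cat /=; lia.
  exists z, q; split=> // v /sub.
  by rewrite !(mem_rcons, mem_cat, inE) => /or3P[]->; rewrite ?orbT.
have nd : ~ null_homotopic X x (a ++ y :: d).
  move=> nd; apply: np; apply: homotopic_trans nd; rewrite pE.
  by have := homotopic_cat (x :: a) d nb; rewrite /= cat_rcons.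
have [|z [q [zq uq nq sub]]] := IH x (a ++ y :: d) _ cd nd.
  by move: pm; rewrite pE !size_cat /= size_cat /=; lia.
exists z, q; split=> // v /sub.
by rewrite !(mem_cat, inE) => /or4P[]->; rewrite ?orbT.
Qed.

Lemma uniq_take_drop (T : eqType) (s : seq T) i j :
  i <= j -> uniq s -> uniq (take i s ++ drop j s).
Proof.
move=> ij; apply: subseq_uniq; rewrite -[X in subseq _ X](cat_take_drop i s).
by rewrite cat_subseq // -(subnK ij) -drop_drop drop_subseq.
Qed.

Lemma mem_take_edge_ball x p i : edge_path X x p ->
  {subset take i p <= [pred v | `[< edge_ball X x i v >]]}.
Proof.
move=> [Xx xp] v /[dup] /splitPr; case E : _ / => [a b] _.
apply/asboolP; exists (rcons a v); rewrite last_rcons; split=> //.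
- split=> //; have : path (edge X) x (take i p) by exact: take_path.
  by rewrite E -cat_rcons cat_path => /andP[].
- have : size (take i p) <= i by rewrite size_take_min geq_minl.
  by rewrite E size_cat size_rcons /=; lia.
Qed.

(** The first [j] entries of [p] follow the centre [x] and the last [k] entries
    lead back to it. The last entry is [x] itself, which is why [k] may be
    [i.+1]; the two arcs are disjoint because their total length is at most that
    of the loop. *)
Lemma loop_ball_card (W : {fset V}) x p i j k :
  closed_edge_path X x p -> uniq p -> {subset x :: p <= W} ->
  j <= i -> k <= i.+1 -> j + k <= size p ->
  j + k <= #|` trace W (edge_ball X x i)|.
Proof.
move=> [xp xl] up pW ji ki jk.
set s := take j p ++ drop (size p - k) p.
have us : uniq s by apply: uniq_take_drop => //; lia.
have -> : j + k = size s by rewrite size_cat size_takel ?size_drop; lia.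
apply: uniq_leq_size us _ => v; rewrite mem_cat in_trace => vs.
apply/andP; split.
  by apply: pW; rewrite inE; case/orP: vs => [/mem_take|/mem_drop] ->; rewrite orbT.
apply/asboolP; case/orP: vs => vs.
  by apply: edge_ball_leq ji _ _; apply/asboolP; exact: mem_take_edge_ball vs.
move: vs ki jk {s}; case: k => [|k]; first by rewrite subn0 drop_size.
move=> vs ki jk.
apply: edge_ball_leq (ki : k <= i) _ _.
have xq : edge_path X x (rev (belast x p)).
  by split; [case: xp | rewrite -{1}xl; apply: path_rev_belast; case: xp].
have : v \in take k.+1 (x :: rev (belast x p)).
  rewrite -{1}xl -rev_rcons -lastI rev_cons -cats1 takel_cat ?size_rev; last by lia.
  by rewrite take_rev mem_rev.
rewrite /= inE => /orP[/eqP->|/(mem_take_edge_ball xq)/asboolP//].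
by exists [::]; split=> //; split=> //; case: xp.
Qed.

Lemma vertex_bound_sum r n i :
  vertex_bound r n.+2 i = \sum_(0 <= j < i.+1) vertex_bound r n.+1 j.
Proof. by []. Qed.

Lemma vertex_bound_step r n i :
  vertex_bound r n.+2 i.+1 = vertex_bound r n.+2 i + vertex_bound r n.+1 i.+1.
Proof. by rewrite !vertex_bound_sum [in LHS]big_nat_recr. Qed.

(** The core of the theorem, by induction on the number of colours. The centre
    is found on a simple loop for one colour; otherwise it is the centre given
    by the induction hypothesis for the smallest [Z] with trivial complement,
    and the bounds for [Z] add up over the radii by [sphere_geq]. The balls are
    those of [X], even though only vertices of [W] are counted, so that the
    distances do not change when [W] shrinks to [Z]. *)
Lemma not_colorable_ball r n (W : {fset V}) :
  short_null_homotopic X (2 * r + 2) -> ~ colorable X n.+1 [set` W]%classic ->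
  exists2 x, vertices X x & forall i, i <= r.+1 ->
    vertex_bound r n.+1 i <= #|` trace W (edge_ball X x i)|.
Proof.
move=> short; elim: n W => [|n IH] W ncol.
- have /existsNP[x /existsNP[p /not_implyP[xp /not_implyP[pW np]]]] :
      ~ pi1_trivial X [set` W]%classic by move=> /colorable1.
  have [y [q [yq uq nq qp]]] := nonnull_uniq_loop xp np.
  have qr : 2 * r + 2 <= size q.
    by rewrite leqNgt; apply/negP => /(short _ _ yq).
  have qW : {subset y :: q <= W} by move=> v /qp /pW.
  exists y; first by case: yq => -[].
  move=> i ir /=; case: (leqP i r) => ri.
  + have := @loop_ball_card W y q i i i.+1 yq uq qW; lia.
  (* The loop may have length exactly [2 * r + 2], and then the two arcs of
     [r.+1] steps share their far end: one of them is shortened. *)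
  + have := @loop_ball_card W y q i r.+1 r.+1 yq uq qW. lia.
- pose good (Z : {fset V}) :=
    Z `<=` W /\ pi1_trivial X [set v | v \in (W `\` Z)%fset]%classic.
  have exZ : exists k, `[< exists2 Z, good Z & #|` Z| = k >].
    exists #|` W|; apply/asboolP; exists W => //; split; first exact: fsubset_refl.
    by move=> x p _ /(_ x (mem_head _ _)); rewrite /= fsetDv inE.
  have [k /asboolP[Z [ZW tZ] Zk] minZ] := ex_minnP exZ.
  have ncolZ : ~ colorable X n.+1 [set` Z]%classic.
    move=> colZ; apply: ncol; apply: colorable_setD colZ _.
    apply: pi1_trivial_sub tZ => v [/= Wv /negP nZ].
    by rewrite inE nZ Wv.
  have [x Xx xZ] := IH Z ncolZ; exists x => //.
  elim=> [_|i IHi ir].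
    rewrite vertex_bound_sum big_nat1; apply: leq_trans (xZ _ _) _ => //.
    apply/fsubset_leq_card/fsubsetP => v.
    by rewrite !in_trace => /andP[/(fsubsetP ZW)-> ->].
  rewrite vertex_bound_step.
  apply: leq_trans (leq_add (IHi (ltnW ir)) (xZ _ ir)) _.
  apply: sphere_geq => //.
    move=> Z' Z'W tZ'; rewrite Zk; apply: minZ; apply/asboolP.
    by exists Z'.
  apply: pi1_trivial_ball => y p yp pi; apply: short yp _; lia.
Qed.

Lemma trace_card_le (W : {fset V}) (Y : set V) k :
  k <= #|` trace W Y| -> (`I_k #<= Y)%card.
Proof.
move=> kW; apply: card_le_trans (subset_card_le (A := [set` trace W Y]%classic) _).
  have -> : (`I_k #<= [set` trace W Y])%card = (`I_k #<= `I_#|` trace W Y|)%card.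
    by apply: card_le_eqr; apply/card_eq_fsetP.
  by rewrite card_le_II.
by move=> v /=; rewrite in_trace => /andP[_ /asboolP].
Qed.

End Balls.

(** * Closed forms of the bounds *)

Lemma vertex_boundE r n i : i <= r ->
  vertex_bound r n.+1 i = 2 * 'C(i + n, n.+1) + 'C(i + n, n).
Proof.
elim: n i => [|n IH] i ir; first by rewrite /= ir addn0 bin1 bin0.
elim: i ir => [|i IHi] ir.
  by rewrite vertex_bound_sum big_nat1 IH // !add0n !binn !bin_small.
rewrite vertex_bound_step IHi ?IH //; last exact: ltnW.
rewrite !addSn !addnS !binS; lia.
Qed.

Lemma vertex_bound_last r n :
  (vertex_bound r n.+1 r.+1).+1 = 2 * 'C(r.+1 + n, n.+1) + 'C(r.+1 + n, n).
Proof.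
elim: n => [|n IH]; first by rewrite /= ltnn addn0 bin1 bin0; lia.
rewrite vertex_bound_step -addnS IH vertex_boundE //.
rewrite !addSn !addnS !binS; lia.
Qed.

Theorem theorem1p7 (V : choiceType) (X : simplicial_complex V) (n r : nat)
    (n_ge1 : 1 <= n)
    (X_essential : combinatorially_essential n X)
    (r_radius : is_homotopy_triviality_radius X r) :
  (exists x : V, vertices X x /\
     forall i : nat, i <= r + 1 ->
       (`I_(vertex_bound r n i) #<= edge_ball X x i)%card) /\
  (forall i : nat, i <= r ->
     2 * 'C(i + n - 1, n) + 'C(i + n - 1, n - 1) <= vertex_bound r n i) /\
  2 * 'C(r + n, n) + 'C(r + n, n - 1) - 1 <= vertex_bound r n (r + 1).
Proof.
case: n n_ge1 X_essential => // n _ ess.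
have -> : r + 1 = r.+1 by rewrite addn1.
split; last split.
- have [s sysX rE] := r_radius; have [short _] := sysX; have s2 := systole_gt2 sysX.
  have short' : short_null_homotopic X (2 * r + 2).
    have rs : 2 * r + 2 <= s.
      by rewrite rE; lia.
    by move=> x p xp pr; apply: short xp (leq_trans pr rs).
  have [W ncol] : exists W : {fset V}, ~ colorable X n.+1 [set` W]%classic.
    apply/existsNP => /colorable_compact col.
    exact: colorable_not_essential col ess.
  have [x Xx xW] := not_colorable_ball short' ncol.
  by exists x; split=> // i /xW; exact: trace_card_le.
- by move=> i ir; rewrite vertex_boundE // addnS !subn1 /=.
- rewrite -addSnnS subSS subn0 -vertex_bound_last.
  by rewrite subSS subn0.
Qed.
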